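(* Assume the Continuum Hypothesis. Then there exists a maximal almost disjoint (MAD) family $\mathcal{F}_-$ of infinite subsets of $\mathbb{N}$ such that the Johnson-Lindenstrauss space $JL_2(\mathcal{F}_-)$ does not have Efremov's property $(\mathcal{E})$.
   Context: All Banach spaces are real; $X^*$ is the topological dual of $X$. An almost disjoint family is a family of infinite subsets of $\mathbb{N}$ any two distinct members of which have finite intersection; it is a maximal almost disjoint (MAD) family if it is maximal with respect to inclusion among almost disjoint families. For an almost disjoint family $\mathcal{F}$, the Johnson-Lindenstrauss space $JL_2(\mathcal{F})$ is the completion of $\operatorname{span}(c_0\cup\{\chi_N : N\in\mathcal{F}\})\subseteq \ell_\infty$ with respect to the norm $$\Big\|x+\sum_{r=1}^k a_r\chi_{N_r}\Big\|_{JL_2(\mathcal{F})}:=\max\Big\{\Big\|x+\sum_{r=1}^k a_r\chi_{N_r}\Big\|_\infty,\ \Big(\sum_{r=1}^k a_r^2\Big)^{1/2}\Big\},$$ where $x\in c_0$, $N_1,\dots,N_k\in\mathcal{F}$ are distinct, $a_1,\dots,a_k\in\mathbb{R}$, and $\chi_N$ is the characteristic function of $N\subseteq\mathbb{N}$. A Banach space $X$ has Efremov's property $(\mathcal{E})$ if for every convex bounded set $C\subseteq X^*$, every element of the weak$^*$-closure of $C$ is the weak$^*$-limit of a sequence in $C$. *)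

(* Defs.v *)
From HB Require Import structures.
From mathcomp Require Import all_boot all_order all_algebra.
From mathcomp Require Import all_classical all_reals all_analysis.

Set Implicit Arguments.
Unset Strict Implicit.
Unset Printing Implicit Defensive.

Import Order.TTheory GRing.Theory Num.Theory.
Import numFieldNormedType.Exports.

Local Open Scope classical_set_scope.
Local Open Scope card_scope.
Local Open Scope ring_scope.

(* [countable] includes finite, and the continuum is the cardinality of the
   power set of nat. *)
Definition continuum_hypothesis : Prop :=
  forall A : set (set nat), countable A \/ A #= [set: set nat].

Definition almost_disjoint (F : set (set nat)) : Prop :=
  (forall N, F N -> infinite_set N) /\
  (forall M N, F M -> F N -> M <> N -> finite_set (M `&` N)).

Definition mad_family (F : set (set nat)) : Prop :=
  almost_disjoint F /\
  (forall G, almost_disjoint G -> F `<=` G -> G = F).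

Definition linear_subspace (R : realType) (V : lmodType R) (A : set V) : Prop :=
  A 0 /\ (forall (a : R) (u v : V), A u -> A v -> A (a *: u + v)).

Definition linear_span (R : realType) (V : lmodType R) (S : set V) : set V :=
  smallest (@linear_subspace R V) S.

Definition c0 (R : realType) : set (nat -> R^o) :=
  [set x | x @ \oo --> (0 : R^o)].

Definition jl_span (R : realType) (F : set (set nat)) : set (nat -> R^o) :=
  linear_span (@c0 R `|` [set (\1_N : nat -> R^o) | N in F]).

(* Only used for bounded y, where [sup] is the actual supremum. *)
Definition sup_norm (R : realType) (y : nat -> R^o) : R :=
  sup (range (fun n => `|y n|)).

(* X, together with the embedding j of jl_span F, is the completion of
   jl_span F for the Johnson-Lindenstrauss norm. The values of j outside
   jl_span F are irrelevant. The members N_r of F are distinct (N is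
   injective), so the norm equation is the defining formula of the norm; it
   determines (X, j) up to a unique linear isometry. *)
Definition JL2_completion (R : realType) (F : set (set nat))
    (X : completeNormedModType R) (j : (nat -> R^o) -> X) : Prop :=
  [/\ forall (a : R) (y z : nat -> R^o), jl_span F y -> jl_span F z ->
        j (a *: y + z) = a *: j y + j z,
      forall (x : nat -> R^o) (k : nat) (a : 'I_k -> R) (N : 'I_k -> set nat),
        c0 x -> injective N -> (forall r, F (N r)) ->
        let y : nat -> R^o := x + \sum_(r < k) a r *: (\1_(N r) : nat -> R^o) in
        `|j y| = Num.max (sup_norm y) (Num.sqrt (\sum_(r < k) a r ^+ 2)) &
      dense (j @` jl_span F)].

Definition is_JL2 (R : realType) (F : set (set nat))
    (X : completeNormedModType R) : Prop :=
  exists j : (nat -> R^o) -> X, JL2_completion F j.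

Definition topological_dual (R : realType) (X : normedModType R) :
    set (X -> R^o) :=
  [set f | linear f /\ continuous f].

(* The weak-* topology on the dual is the topology of pointwise convergence,
   i.e. the one induced by {ptws X -> R^o}. [uniform_bounded C] says that C is
   uniformly bounded on balls, i.e. bounded for the dual norm. *)
Definition efremov_property (R : realType) (X : normedModType R) : Prop :=
  forall C : set (X -> R^o),
    C `<=` @topological_dual R X ->
    convex_set C ->
    uniform_bounded C ->
    forall f : X -> R^o, topological_dual f ->
      closure (C : set {ptws X -> R^o}) f ->
      exists u : nat -> X -> R^o,
        (forall n, C (u n)) /\ {ptws, u @ \oo --> f}.

(* Main.v *)
(* Under CH the sequences of finitely supported probability measures on nat
   can be enumerated by a well-order with countable initial segments. Along it
   one builds an almost disjoint family F: if the current measures mu_k tend to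
   0 on every point and on the countably many sets e_0, e_1, ... obtained so
   far, add the union over i of supp mu_(k_i) minus (e_0, ..., e_(i-1)), where
   k_i >= i is such that mu_(k_i) gives mass at most 1/2 to the sets removed;
   the measures do not tend to 0 on it. Hence no sequence of measures tends to
   0 on all points and all members of F. Dirac measures show that F is maximal.
   Let C be the convex hull of the evaluations y |-> y n in the dual of JL_2(F).
   Since F is infinite, 0 is in the weak* closure of C, but a sequence of C
   tending weak* to 0 would be a sequence of measures tending to 0 on all points
   and all members of F. *)
From HB Require Import structures.
Require Import Defs.
From mathcomp Require Import all_boot all_order all_algebra.
From mathcomp Require Import all_classical all_reals all_analysis.
From mathcomp Require Import wochoice ring lra.

Set Implicit Arguments.
Unset Strict Implicit.
Unset Printing Implicit Defensive.

Import Order.TTheory GRing.Theory Num.Theory.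
Import numFieldNormedType.Exports.

Local Open Scope classical_set_scope.
Local Open Scope card_scope.
Local Open Scope ring_scope.

(** * Uniform closures of spaces of bounded functions *)

Lemma half_lt (R : realType) (e : R) : 0 < e -> e / 2 < e.
Proof. by move=> e0; rewrite gtr_pMr// invf_lt1 ?ltr1n. Qed.

Lemma sup_range_le (R : realType) (I : Type) (f : I -> R) (M : R) :
  0 <= M -> (forall i, f i <= M) -> sup (range f) <= M.
Proof.
move=> M0 fM; have [->|/set0P S0] := eqVneq (range f) set0.
  by rewrite sup0.
by apply: sup_le_ub => // _ [i _ <-].
Qed.

Lemma sup_range_ge0 (R : realType) (I : Type) (f : I -> R) :
  (forall i, 0 <= f i) -> 0 <= sup (range f).
Proof.
move=> f0; have [hs|/sup_out ->//] := pselect (has_sup (range f)).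
have [[x [i _ _]] ubf] := hs.
by apply: le_trans (f0 i) (ub_le_sup _ _) => //; exists i.
Qed.

Record bounded_subspace (R : realType) (I : Type) := BoundedSubspace {
  bsub_set : set (I -> R^o);
  bsub_linear : linear_subspace bsub_set;
  bsub_bounded : forall f, bsub_set f -> exists M, forall i, `|f i| <= M }.

Definition uniform_closure (R : realType) (I : Type)
    (A : bounded_subspace R I) : {pred I -> R^o} :=
  [pred f | `[< forall e : R, 0 < e ->
                exists2 h, bsub_set A h & forall i, `|f i - h i| <= e >]].

Lemma uniform_closure_submod (R : realType) (I : Type)
  (A : bounded_subspace R I) : submod_closed (uniform_closure A).
Proof.
have [A0 Alin] := bsub_linear A.
split.
  apply/asboolP => e e0; exists 0 => // i.
  by rewrite subrr normr0 ltW.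
move=> a u v /asboolP Au /asboolP Av; apply/asboolP => e e0.
have d0 : 0 < e / (`|a| + 1) / 2 by rewrite !divr_gt0// ltr_wpDl.
have e20 : 0 < e / 2 by rewrite divr_gt0.
have [h Ah hP] := Au _ d0; have [g Ag gP] := Av _ e20.
exists (a *: h + g) => [|i]; first exact: Alin.
rewrite /= opprD addrACA; apply: le_trans (ler_normD _ _) _.
rewrite [leRHS]splitr lerD//.
rewrite -scalerBr normrZ.
apply: le_trans (_ : `|a| * (e / (`|a| + 1) / 2) <= _).
  by rewrite ler_wpM2l.
rewrite mulrA ler_pM2r// mulrCA ger_pMr//.
by rewrite ler_pdivrMr ?ltr_wpDl// mul1r lerDl.
Qed.

HB.instance Definition _ (R : realType) (I : Type) (A : bounded_subspace R I) :=
  GRing.isSubmodClosed.Build R (I -> R^o) (uniform_closure A)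
    (uniform_closure_submod A).

(** A closed subspace of the bounded functions on [I] with the sup norm, hence a Banach space: a
    completion obtained without Cauchy sequences. *)
Record bclosure (R : realType) (I : Type) (A : bounded_subspace R I) :=
  BClosure { bval : I -> R^o; _ : bval \in uniform_closure A }.

HB.instance Definition _ (R : realType) (I : Type) (A : bounded_subspace R I) :=
  [isSub for @bval R I A].
HB.instance Definition _ (R : realType) (I : Type) (A : bounded_subspace R I) :=
  [Choice of bclosure A by <:].
HB.instance Definition _ (R : realType) (I : Type) (A : bounded_subspace R I) :=
  [SubChoice_isSubLmodule of bclosure A by <:].

Lemma bvalP (R : realType) (I : Type) (A : bounded_subspace R I)
  (x : bclosure A) (e : R) : 0 < e ->
  exists2 h, bsub_set A h & forall i, `|bval x i - h i| <= e.
Proof. by case: x => f /= /asboolP; apply. Qed.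

Lemma bval_bounded (R : realType) (I : Type) (A : bounded_subspace R I)
  (x : bclosure A) : exists M, forall i, `|bval x i| <= M.
Proof.
have [h Ah hP] := bvalP x ltr01; have [M MP] := bsub_bounded Ah.
exists (1 + M) => i.
by rewrite -[bval x i](subrK (h i)) (le_trans (ler_normD _ _))// lerD.
Qed.

Definition bnorm (R : realType) (I : Type) (A : bounded_subspace R I)
  (x : bclosure A) : R := sup (range (fun i => `|bval x i|)).

Section bclosure_norm.
Context (R : realType) (I : Type) (A : bounded_subspace R I).
Implicit Type x y : bclosure A.

Lemma bnorm_ub x i : `|bval x i| <= bnorm x.
Proof.
have [M MP] := bval_bounded x.
by apply: ub_le_sup; [exists M => _ [k _ <-]| exists i].
Qed.

Lemma bnorm_le x M : 0 <= M -> (forall i, `|bval x i| <= M) -> bnorm x <= M.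
Proof. exact: sup_range_le. Qed.

Lemma bnorm_ge0 x : 0 <= bnorm x.
Proof. exact: sup_range_ge0. Qed.

Lemma bnormD x y : bnorm (x + y) <= bnorm x + bnorm y.
Proof.
apply: bnorm_le => [|i]; first by rewrite addr_ge0 ?bnorm_ge0.
by rewrite (le_trans (ler_normD _ _))// lerD// bnorm_ub.
Qed.

Lemma bnormZ (l : R) x : bnorm (l *: x) = `|l| * bnorm x.
Proof.
have Z (k : R) (z : bclosure A) : bnorm (k *: z) <= `|k| * bnorm z.
  apply: bnorm_le => [|i]; first by rewrite mulr_ge0// bnorm_ge0.
  by rewrite /= normrM ler_wpM2l// bnorm_ub.
apply/eqP; rewrite eq_le Z/=; have [->|l0] := eqVneq l 0.
  by rewrite normr0 mul0r bnorm_ge0.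
(* The reverse inequality is [Z] for the inverse of [l], applied to [l *: x]. *)
rewrite -ler_pdivlMl ?normr_gt0// -normfV.
by rewrite -[leLHS](congr1 (@bnorm _ _ _) (scalerK l0 x)) Z.
Qed.

Lemma bnorm_eq0 x : bnorm x = 0 -> x = 0.
Proof.
move=> x0; apply/val_inj/funext => i.
by apply/eqP; rewrite -normr_le0 -x0 bnorm_ub.
Qed.

HB.instance Definition _ :=
  @Lmodule_isNormed.Build R (bclosure A) (@bnorm R I A) bnormD bnormZ bnorm_eq0.

Lemma bclosure_norm x : `|x| = bnorm x.
Proof. by []. Qed.

(** A Cauchy filter converges at each [i]. Letting [y] run along [F] in the uniform bound on
    [bval x i - bval y i] makes the convergence uniform and puts the limit in the closure. *)
Lemma bclosure_complete (F : set_system (bclosure A)) :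
  ProperFilter F -> cauchy F -> cvg F.
Proof.
move=> PF /cauchyP Fc.
have {}Fc (e : R) : 0 < e ->
    exists x, F [set y | forall i, `|bval x i - bval y i| <= e].
  move=> e0; have [x Fx] := Fc _ e0; exists x.
  apply: (@filterS _ F _ _ _ _ Fx) => y; rewrite -ball_normE /ball_/= => xy i.
  by apply: le_trans (ltW xy); apply: (bnorm_ub (x - y)).
have cF i : cvg ((fun x => bval x i : R^o) @ F).
  apply: cauchy_cvg; apply/cauchyP => e e0.
  have [x Fx] := Fc (e / 2) (divr_gt0 e0 (ltr0Sn _ 1)); exists (bval x i).
  apply: (@filterS _ F _ _ _ _ Fx) => y xy.
  have {}xy : `|bval x i - bval y i| <= e / 2 := xy i.
  rewrite /= -ball_normE /ball_/=.
  by apply: le_lt_trans xy _; exact: half_lt.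
pose g i : R^o := lim ((fun x => bval x i : R^o) @ F).
have gP e : 0 < e -> exists x, F [set y | forall i, `|bval x i - bval y i| <= e]
    /\ forall i, `|bval x i - g i| <= e.
  move=> e0; have [x Fx] := Fc _ e0; exists x; split => // i.
  have cd : (bval x i - bval y i @[y --> F]) --> bval x i - g i.
    by apply: cvgB; [exact: cvg_cst | exact: cF].
  rewrite -(cvg_lim _ (cvg_norm cd))//; apply: limr_le.
    by apply: cvgP (cvg_norm cd).
  by apply: (@filterS _ F _ _ _ _ Fx) => y xy; exact: xy.
have gA : g \in uniform_closure A.
  apply/asboolP => e e0; have e2 : 0 < e / 2 by rewrite divr_gt0.
  have [x [_ xg]] := gP _ e2; have [h Ah xh] := bvalP x e2; exists h => // i.
  rewrite -[g i - h i](subrKA (bval x i)) (le_trans (ler_normD _ _))//.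
  by rewrite [leRHS]splitr lerD// distrC.
apply: (@cvgP _ _ (BClosure gA : bclosure A)).
apply/cvg_ballP => e e0.
(* Two errors of [e / 4] bound the norm by [e / 2], which leaves room for the strict inequality of
   the open ball. *)
have e4 : 0 < e / 2 / 2 by rewrite !divr_gt0.
have [x [Fx xg]] := gP _ e4; apply: (@filterS _ F _ _ _ _ Fx) => y xy.
rewrite -ball_normE /ball_/=; apply: (@le_lt_trans _ _ (e / 2)); last first.
  exact: half_lt.
apply: bnorm_le => [|i]; first by rewrite ltW// divr_gt0.
rewrite (_ : bval _ i = g i - bval y i)// -[_ - _](subrKA (bval x i)).
rewrite (le_trans (ler_normD _ _))//.
by rewrite [leRHS]splitr lerD// distrC.
Qed.

HB.instance Definition _ := Uniform_isComplete.Build (bclosure A) bclosure_complete.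

End bclosure_norm.

(** * A model of the Johnson-Lindenstrauss space *)

Lemma finite_set_natP (A : set nat) :
  finite_set A <-> exists m, forall n, A n -> (n < m)%N.
Proof.
split=> [/finite_seqP[s ->]|[m Am]]; last exact: sub_finite_set (finite_II m).
exists (\max_(i <- s) i).+1 => n /= sn.
by rewrite ltnS (leq_bigmax_seq (F := id) n).
Qed.

(** * Limits along an infinite set, and coefficients *)

Definition along (N : set nat) : set_system nat := within N \oo.

Instance along_filter (N : set nat) : Filter (along N).
Proof. exact: within_filter. Qed.

Lemma along_proper (N : set nat) : infinite_set N -> ProperFilter (along N).
Proof.
move=> Ninf; apply: Build_ProperFilter_ex => P [m _ mP].
apply: contrapT => nP; apply: Ninf; apply/finite_set_natP; exists m => n Nn.
by rewrite ltnNge; apply/negP => mn; apply: nP; exists n; apply: mP.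
Qed.

Lemma cvg_c0_along (R : realType) (N : set nat) (x : nat -> R^o) :
  c0 x -> x @ along N --> (0 : R^o).
Proof. by move=> x0; apply: cvg_trans x0; apply: cvg_app; apply: cvg_within. Qed.

Lemma cvg_indic_along (R : realType) (N : set nat) :
  (\1_N : nat -> R^o) @ along N --> (1 : R^o).
Proof.
apply: cvg_near_cst; rewrite near_withinE; apply: nearW => n Nn.
by rewrite indicE mem_set.
Qed.

Lemma near_indic_along0 (R : realType) (M N : set nat) : finite_set (M `&` N) ->
  \forall n \near along N, \1_M n = 0 :> R.
Proof.
move=> /finite_set_natP[m MNm]; rewrite near_withinE.
exists m => // n mn Nn; rewrite indicE memNset// => Mn.
by have := MNm n (conj Mn Nn); rewrite ltnNge mn.
Qed.

Lemma cvg_indic_along0 (R : realType) (M N : set nat) : finite_set (M `&` N) ->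
  (\1_M : nat -> R^o) @ along N --> (0 : R^o).
Proof. by move=> MN; apply: cvg_near_cst; exact: near_indic_along0. Qed.

Lemma jl_span_linear (R : realType) (F : set (set nat)) :
  linear_subspace (@jl_span R F).
Proof.
split=> [A [[]]//|a u v Fu Fv A AF].
by apply: AF.1.2; [exact: Fu | exact: Fv].
Qed.

Lemma jl_span_c0 (R : realType) (F : set (set nat)) (x : nat -> R^o) :
  c0 x -> jl_span F x.
Proof. by move=> x0; apply: sub_gen_smallest; left. Qed.

Lemma jl_span_indic (R : realType) (F : set (set nat)) (N : set nat) :
  F N -> jl_span F (\1_N : nat -> R^o).
Proof. by move=> FN; apply: sub_gen_smallest; right; exists N. Qed.

Lemma jl_span_ind (R : realType) (F : set (set nat)) (P : set (nat -> R^o)) :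
  linear_subspace P -> (forall x, c0 x -> P x) ->
  (forall N, F N -> P (\1_N : nat -> R^o)) -> forall y, jl_span F y -> P y.
Proof.
move=> Plin Pc0 PF; apply: smallest_sub => // y [|[N FN <-]]; first exact: Pc0.
exact: PF.
Qed.

Lemma c0_bounded (R : realType) (x : nat -> R^o) :
  c0 x -> exists M, forall n, `|x n| <= M.
Proof.
move=> x0; have [M [_ MP]] := cvg_seq_bounded (cvgP _ x0).
by exists (M + 1) => n; apply: MP => //; rewrite ltrDl.
Qed.

(* The coefficient of [\1_N] in an element of the span is its limit along N. *)
Definition coef (R : realType) (N : set nat) (y : nat -> R^o) : R^o :=
  lim (y @ along N).

(* A norming set of functionals: the supremum of their absolute values is the
   norm, so the completion is a space of bounded functions on this type. *)
Inductive jl_functional (R : realType) (F : set (set nat)) :=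
| Eval of nat
| Coef k (b : 'I_k -> R) (N : 'I_k -> set nat) of
    injective N & (forall r, F (N r)) & \sum_(r < k) b r ^+ 2 <= 1.

Definition jl_embed (R : realType) (F : set (set nat)) (y : nat -> R^o)
    (i : jl_functional R F) : R^o :=
  match i with
  | Eval n => y n
  | Coef k b N _ _ _ => \sum_(r < k) b r * coef (N r) y
  end.
Arguments jl_embed {R} F y i.

Section jl_embed.
Context (R : realType) (F : set (set nat)).
Hypothesis adF : almost_disjoint F.

(** A null sequence tends to 0 along [N], and for [M] in [F] the function [\1_M] is eventually
    constant along [N]: 1 if [M = N], and 0 otherwise by almost disjointness. *)
Lemma cvg_jl_span (y : nat -> R^o) (N : set nat) :
  F N -> jl_span F y -> y @ along N --> coef N y.
Proof.
move=> FN; have PN := along_proper (adF.1 _ FN).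
suff: jl_span F y -> cvg (y @ along N) by [].
move: y; apply: jl_span_ind.
- split=> [|a u v cu cv]; first by apply: cvgP; exact: cvg_cst.
  apply: (cvgP (a *: coef N u + coef N v)).
  by apply: cvgD => //; apply: cvgZl_tmp.
- by move=> x x0; exact: cvgP (cvg_c0_along N x0).
- move=> M FM; have [->|/eqP MN] := eqVneq M N.
    exact: cvgP (@cvg_indic_along R N).
  exact: cvgP (@cvg_indic_along0 R M N (adF.2 _ _ FM FN MN)).
Qed.

Lemma coef_linear (N : set nat) (a : R) (u v : nat -> R^o) :
  F N -> jl_span F u -> jl_span F v ->
  coef N (a *: u + v) = a *: coef N u + coef N v.
Proof.
move=> FN Fu Fv; have PN := along_proper (adF.1 _ FN).
apply: cvg_lim => //.
by apply: cvgD; [apply: cvgZl_tmp|]; apply: cvg_jl_span.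
Qed.

(** The family [M] may repeat a set, so the coefficient at [N] is a sum over all indices [s] with
    [M s = N]. *)
Lemma coef_sum (x : nat -> R^o) (k : nat) (a : 'I_k -> R)
    (M : 'I_k -> set nat) (N : set nat) :
  c0 x -> (forall s, F (M s)) -> F N ->
  coef N (x + \sum_(s < k) a s *: (\1_(M s) : nat -> R^o)) =
  \sum_(s < k) a s * (N == M s)%:R.
Proof.
move=> x0 FM FN; have PN := along_proper (adF.1 _ FN).
apply: cvg_lim => //.
rewrite -[X in _ --> X]add0r; apply: cvgD; first exact: cvg_c0_along.
have -> : \sum_(s < k) a s *: (\1_(M s) : nat -> R^o) =
    (fun n => \sum_(s < k) a s *: (\1_(M s) n : R^o)).
  by apply/funext => n; rewrite fct_sumE.
apply: cvg_big => [|s _]; first exact: add_continuous.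
apply: cvgZl_tmp; have [<-|/eqP NM] := eqVneq N (M s).
  exact: cvg_indic_along.
by apply/cvg_indic_along0/adF.2 => // /esym.
Qed.

Lemma jl_embed_linear (a : R) (u v : nat -> R^o) :
  jl_span F u -> jl_span F v ->
  jl_embed F (a *: u + v) = a *: jl_embed F u + jl_embed F v.
Proof.
move=> Fu Fv; apply/funext => -[//|k b N injN FN b1] /=.
rewrite -[RHS]/(a * (\sum_(r < k) b r * coef (N r) u) +
                \sum_(r < k) b r * coef (N r) v).
rewrite mulr_sumr -big_split/=; apply: eq_bigr => r _.
by rewrite coef_linear// -[a *: _]/(a * _) mulrDr mulrCA.
Qed.

End jl_embed.

(** * Finite sums and the Cauchy-Schwarz inequality *)

Lemma sum_eq_op_le1 (R : realType) (T : eqType) k (N : 'I_k -> T) (x : T) :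
  injective N -> \sum_(r < k) ((N r == x)%:R : R) <= 1.
Proof.
move=> injN; case: (pselect (exists r, N r = x)) => [[r <-]|nN].
  rewrite (bigD1 r)//= eqxx big1 ?addr0// => i ir.
  by rewrite (inj_eq injN) (negbTE ir).
rewrite big1// => r _; case: eqP => // Nr.
by case: nN; exists r.
Qed.

(** By injectivity at most one term is nonzero, so there are no cross terms. *)
Lemma sqr_sum_eq_op (R : realType) (T : eqType) k (a : 'I_k -> R)
    (M : 'I_k -> T) (x : T) : injective M ->
  (\sum_(s < k) a s * (x == M s)%:R) ^+ 2 =
  \sum_(s < k) a s ^+ 2 * (x == M s)%:R.
Proof.
move=> injM; case: (pselect (exists s, M s = x)) => [[s <-]|nM].
  have E (c : 'I_k -> R) : \sum_(i < k) c i * (M s == M i)%:R = c s.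
    rewrite (bigD1 s)//= eqxx mulr1 big1 ?addr0// => i /negbTE si.
    by rewrite (inj_eq injM) eq_sym si mulr0.
  by rewrite !E.
have E (c : 'I_k -> R) : \sum_(i < k) c i * (x == M i)%:R = 0.
  rewrite big1// => i _; case: eqP => [xM|]; last by rewrite mulr0.
  by case: nM; exists i.
by rewrite !E expr0n.
Qed.

Lemma cauchy_schwarz_le1 (R : realType) k (b c : 'I_k -> R) (S : R) :
  0 <= S -> \sum_(r < k) b r ^+ 2 <= 1 -> \sum_(r < k) c r ^+ 2 <= S ^+ 2 ->
  `|\sum_(r < k) b r * c r| <= S.
Proof.
rewrite le_eqVlt => /predU1P[<- _|S0 b1 cS].
  rewrite expr0n/= => c0; rewrite big1 ?normr0// => r _.
  have c0' : \sum_(r < k) c r ^+ 2 = 0.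
    by apply/eqP; rewrite eq_le c0 sumr_ge0// => i _; exact: sqr_ge0.
  have /eqP : c r ^+ 2 = 0 := psumr_eq0P (fun i _ => sqr_ge0 (c i)) c0' isT.
  by rewrite sqrf_eq0 => /eqP->; rewrite mulr0.
(* The arithmetic-geometric mean inequality, weighted by [S] so that both halves sum to at most
   [S]. *)
have bc r : `|b r * c r| <= (S * b r ^+ 2 + c r ^+ 2 / S) / 2.
  rewrite -subr_ge0 [X in 0 <= X](_ : _ = (S * `|b r| - `|c r|) ^+ 2 / S / 2).
    by rewrite !divr_ge0// ?sqr_ge0// ltW.
  rewrite normrM -[b r ^+ 2]real_normK ?num_real// -[c r ^+ 2]real_normK ?num_real//.
  by field; rewrite gt_eqF.
apply: le_trans (ler_norm_sum _ _ _) _.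
apply: le_trans (ler_sum _ (fun r _ => bc r)) _.
rewrite -mulr_suml big_split/= -mulr_sumr -mulr_suml.
have : (\sum_(r < k) c r ^+ 2) / S <= S by rewrite ler_pdivrMr// -expr2.
have : S * (\sum_(r < k) b r ^+ 2) <= S by rewrite ger_pMr.
lra.
Qed.

Section JL2_model.
Context (R : realType) (F : set (set nat)).
Hypothesis adF : almost_disjoint F.

(** The coefficients at the distinct sets [N r] are among the [a s] or zero, so their squares sum to
    at most those of [a]; Cauchy-Schwarz does the rest. *)
Lemma jl_embed_Coef_le (x : nat -> R^o) k (a : 'I_k -> R) (M : 'I_k -> set nat)
    k' (b : 'I_k' -> R) (N : 'I_k' -> set nat) :
  c0 x -> injective M -> (forall s, F (M s)) ->
  injective N -> (forall r, F (N r)) -> \sum_(r < k') b r ^+ 2 <= 1 ->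
  `|\sum_(r < k') b r *
     coef (N r) (x + \sum_(s < k) a s *: (\1_(M s) : nat -> R^o))| <=
  Num.sqrt (\sum_(s < k) a s ^+ 2).
Proof.
move=> x0 injM FM injN FN b1.
apply: cauchy_schwarz_le1 => //.
rewrite sqr_sqrtr; last by rewrite sumr_ge0// => s _; exact: sqr_ge0.
under eq_bigr => r _ do rewrite (coef_sum adF a x0 FM (FN r)) sqr_sum_eq_op//.
rewrite exchange_big/=; apply: ler_sum => s _.
rewrite -mulr_sumr -[leRHS]mulr1 ler_wpM2l ?sqr_ge0//.
exact: sum_eq_op_le1.
Qed.

Lemma jl_embed_bounded (y : nat -> R^o) : jl_span F y ->
  exists B, forall i, `|jl_embed F y i| <= B.
Proof.
move=> Fy.
(* Membership in the span is carried through the induction because [jl_embed] is known to be linear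
   only there. *)
suff: jl_span F y /\ exists B, forall i, `|jl_embed F y i| <= B by case.
have [F0 Flin] := @jl_span_linear R F.
move: Fy; apply: (jl_span_ind (P := fun y => jl_span F y /\
  exists B, forall i, `|jl_embed F y i| <= B)).
- split=> [|a u v [Fu [A uA]] [Fv [B vB]]].
    split=> //; exists 0 => i.
    have := jl_embed_linear adF (-1) F0 F0.
    by rewrite scaler0 addr0 scaleN1r addNr => ->; rewrite normr0.
  split; first exact: Flin.
  exists (`|a| * A + B) => i; rewrite jl_embed_linear//.
  apply: le_trans (ler_normD _ _) _.
  by rewrite lerD// normrM ler_wpM2l.
- move=> x x0; split; first exact: jl_span_c0.
  have [B xB] := c0_bounded x0; exists (Num.max B 0) => -[n|k b N injN FN b1].
    by rewrite le_max xB.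
  (* A null sequence is the case of an empty family of sets, where the bound is 0. *)
  have inj0 : injective (fun i : 'I_0 => set0 : set nat) by move=> [].
  have F0' (i : 'I_0) : F set0 by case: i.
  have := jl_embed_Coef_le (fun => 0) x0 inj0 F0' injN FN b1.
  by rewrite !big_ord0 addr0 sqrtr0 le_max orbC => ->.
- move=> N FN; split; first exact: jl_span_indic.
  exists 1 => -[n|k b M injM FM b1] /=.
    by rewrite indicE ger0_norm// lern1 leq_b1.
  have inj1 : injective (fun i : 'I_1 => N) by move=> i j _; rewrite !ord1.
  have c00 : c0 (0 : nat -> R^o) by apply: cvg_cst.
  have := jl_embed_Coef_le (fun => 1) c00 inj1 (fun => FN) injM FM b1.
  by rewrite !big_ord1 add0r scale1r expr1n sqrtr1.
Qed.

Lemma jl_image_linear : linear_subspace (jl_embed F @` @jl_span R F).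
Proof.
have [F0 Flin] := @jl_span_linear R F; split=> [|a _ _ [u Fu <-] [v Fv <-]].
  exists 0 => //.
  have := jl_embed_linear adF (-1) F0 F0.
  by rewrite scaler0 addr0 scaleN1r addNr.
by exists (a *: u + v); [exact: Flin | rewrite jl_embed_linear].
Qed.

Lemma jl_image_bounded (f : jl_functional R F -> R^o) :
  (jl_embed F @` @jl_span R F) f -> exists B, forall i, `|f i| <= B.
Proof. by move=> [y Fy <-]; exact: jl_embed_bounded. Qed.

Definition jl_image : bounded_subspace R (jl_functional R F) :=
  BoundedSubspace jl_image_linear jl_image_bounded.

(** The default 0 is taken only when [jl_embed F y] is outside the uniform closure, which never
    happens on the span. *)
Definition jl_inclusion (y : nat -> R^o) : bclosure jl_image :=
  insubd 0 (jl_embed F y).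

Lemma jl_inclusionE (y : nat -> R^o) :
  jl_span F y -> bval (jl_inclusion y) = jl_embed F y.
Proof.
move=> Fy; apply: insubdK; apply/asboolP => e e0; exists (jl_embed F y).
  by exists y.
by move=> i; rewrite subrr normr0 ltW.
Qed.

Lemma jl_span_sum (x : nat -> R^o) k (a : 'I_k -> R) (M : 'I_k -> set nat) :
  c0 x -> (forall s, F (M s)) ->
  jl_span F (x + \sum_(s < k) a s *: (\1_(M s) : nat -> R^o)).
Proof.
have [F0 Flin] := @jl_span_linear R F; move=> x0 FM.
have D u v : jl_span F u -> jl_span F v -> @jl_span R F (u + v).
  by move=> Fu Fv; have := Flin 1 u v Fu Fv; rewrite scale1r.
apply: (D); first exact: jl_span_c0.
apply: (big_ind (@jl_span R F) F0 D) => s _; rewrite -[_ *: _]addr0.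
by apply: Flin => //; exact: jl_span_indic.
Qed.

(** The functionals [Eval] give the sup norm. The functionals [Coef] stay below the Euclidean norm
    of [a] and reach it at the normalised vector [a / S]. *)
Lemma jl_norm (x : nat -> R^o) k (a : 'I_k -> R) (M : 'I_k -> set nat) :
  c0 x -> injective M -> (forall s, F (M s)) ->
  let y : nat -> R^o := x + \sum_(s < k) a s *: (\1_(M s) : nat -> R^o) in
  `|jl_inclusion y| = Num.max (sup_norm y) (Num.sqrt (\sum_(s < k) a s ^+ 2)).
Proof.
move=> x0 injM FM y; have Fy : jl_span F y by exact: jl_span_sum.
have [B yB] := jl_embed_bounded Fy.
have ge0 : 0 <= \sum_(s < k) a s ^+ 2 by rewrite sumr_ge0// => s _; exact: sqr_ge0.
rewrite bclosure_norm; apply/eqP; rewrite eq_le; apply/andP; split.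
  apply: bnorm_le => [|i]; rewrite ?le_max ?sqrtr_ge0 ?orbT// jl_inclusionE//.
  case: i => [n|k' b N injN FN b1]; rewrite /=; apply/orP; [left|right].
    by apply: ub_le_sup; [exists B => _ [m _ <-]; exact: (yB (Eval R F m))|exists n].
  exact: jl_embed_Coef_le.
rewrite ge_max; apply/andP; split.
  apply: sup_range_le => [|n]; first exact: bnorm_ge0.
  by have := bnorm_ub (jl_inclusion y) (Eval R F n); rewrite jl_inclusionE.
set S := Num.sqrt _; have := sqrtr_ge0 (\sum_(s < k) a s ^+ 2).
rewrite -/S le_eqVlt => /predU1P[<-|S0]; first exact: bnorm_ge0.
have SE : S ^+ 2 = \sum_(s < k) a s ^+ 2 by rewrite sqr_sqrtr.
have b1 : \sum_(s < k) (a s / S) ^+ 2 <= 1.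
  under eq_bigr => s _ do rewrite expr_div_n.
  by rewrite -mulr_suml -SE divff// sqrf_eq0 gt_eqF.
have := bnorm_ub (jl_inclusion y) (Coef injM FM b1); rewrite jl_inclusionE//=.
apply: le_trans; rewrite (_ : \sum_(r < k) _ = S) ?ger0_norm ?(ltW S0)//.
have cM r : coef (M r) y = a r.
  rewrite (coef_sum adF a x0 FM (FM r)) (bigD1 r)//= eqxx mulr1 big1 ?addr0//.
  by move=> i /negbTE ir; rewrite (inj_eq injM) eq_sym ir mulr0.
under eq_bigr => r _ do rewrite cM mulrAC -expr2.
by rewrite -mulr_suml -SE expr2 mulfK// gt_eqF.
Qed.

(** This keeps a statement about all completions from being vacuous. Density holds by construction
    of the uniform closure. *)
Lemma is_JL2_exists : is_JL2 F (bclosure jl_image : completeNormedModType R).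
Proof.
have [F0 Flin] := @jl_span_linear R F.
exists jl_inclusion; split.
- move=> a y z Fy Fz; apply/val_inj => /=.
  rewrite (jl_inclusionE (Flin _ _ _ Fy Fz)) jl_embed_linear//.
  by rewrite jl_inclusionE// jl_inclusionE.
- by move=> x k a N x0 injN FN; exact: jl_norm.
- move=> O [x Ox] oO.
  have /nbhs_ballP[e /= e0 xeO] : nbhs x O by exact: open_nbhs_nbhs.
  have [_ [y Fy <-] xy] := bvalP x (divr_gt0 e0 (ltr0Sn R 1)).
  exists (jl_inclusion y); split; last by exists y.
  apply: xeO; rewrite -ball_normE /ball_/=; apply: (@le_lt_trans _ _ (e / 2)).
    apply: bnorm_le => [|i]; first by rewrite ltW// divr_gt0.
    rewrite (_ : bval _ i = bval x i - bval (jl_inclusion y) i)//.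
    by rewrite jl_inclusionE.
  exact: half_lt.
Qed.

End JL2_model.

(** * The almost disjoint family *)

Lemma strict_well_order (T : eqType) : exists lt : T -> T -> Prop,
  well_founded lt /\ forall x y, x <> y -> lt x y \/ lt y x.
Proof.
have [le wo_le] := @well_ordering_principle T.
have min_unique (A : {pred T}) x y : minimum_of le A x -> minimum_of le A y -> x = y.
  move=> Ax Ay; have [|z [_ zu]] := wo_le A; first by exists x; case: Ax.
  by rewrite -(zu _ Ax) (zu _ Ay).
pose lt x y : Prop := le x y /\ x <> y.
exists lt; split=> [x|x y xy]; last first.
  have [|z [[/orP[]/eqP-> zl] _]] := wo_le (pred2 x y).
  - by exists x; rewrite !inE eqxx.
  - by left; split=> //; apply: zl; rewrite !inE eqxx orbT.
  - by right; split; [apply: zl; rewrite !inE eqxx|exact/nesym].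
apply: contrapT => nx.
have [|z [[/asboolP nz zl] _]] := wo_le [pred y | `[< ~ Acc lt y >]].
  by exists x; apply/asboolP.
(* Here [z] is the least inaccessible element. An inaccessible [y] below it would also satisfy
   [le z y], so [y] and [z] would both be the minimum of the pair. *)
apply: nz; split=> y [yz ney]; apply: contrapT => ny; apply: ney.
have lzy : le z y by apply: zl; apply/asboolP.
have refl u : le u u.
  have [|v [[/eqP-> vl] _]] := wo_le (pred1 u); first by exists u; rewrite !inE.
  by apply: vl; rewrite !inE.
apply: (min_unique (pred2 y z)); (split; first by rewrite !inE eqxx ?orbT).
  by move=> u /orP[]/eqP->.
by move=> u /orP[]/eqP->.
Qed.

(* If the segments of some well-order are not all countable, the first
   uncountable one has the cardinality of the continuum, by CH. *)
Lemma ch_well_order : continuum_hypothesis ->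
  exists lt : set nat -> set nat -> Prop,
    [/\ well_founded lt, forall x y, x <> y -> lt x y \/ lt y x &
        forall x, countable [set y | lt y x]].
Proof.
move=> CH; have [lt [wf_lt tot_lt]] := @strict_well_order (set nat).
have [ct|nct] := pselect (forall x, countable [set y | lt y x]); first by exists lt.
have [z ncz ctz] : exists2 z, ~ countable [set y | lt y z] &
    forall y, lt y z -> countable [set x | lt x y].
  apply: contrapT => nz; apply: nct; apply: (well_founded_ind wf_lt) => z ctz.
  by apply: contrapT => ncz; apply: nz; exists z.
(* The order is pulled back along a bijection [g] from all subsets of [nat] onto the segment below
   [z]. *)
have [//|/card_esym/card_set_bijP[g [gz ginj _]]] := CH [set y | lt y z].
exists (fun x y => lt (g x) (g y)); split.
- have acc y : Acc lt y -> forall x, g x = y -> Acc (fun x y => lt (g x) (g y)) x.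
    elim=> {}y _ IH x yE; split=> u; rewrite yE => uy.
    exact: IH uy _ erefl.
  by move=> x; exact: acc (wf_lt (g x)) _ erefl.
- move=> x y xy; apply: tot_lt => /ginj gxy; apply: xy.
  by apply: gxy; rewrite inE.
- move=> x; have /countable_injP[f finj] := ctz (g x) (gz x I).
  apply/countable_injP; exists (f \o g) => u v /set_mem ux /set_mem vx.
  move=> /finj gE; apply: ginj; rewrite ?inE//.
  by apply: gE; rewrite inE.
Qed.

(** * Diagonalisation against sequences of finitely supported probability measures *)

Section Diagonal.
Context (R : realType).

Definition mass (w : nat -> R) (K : nat) (M : set nat) : R :=
  \sum_(i < K) w i * \1_M i.

Lemma mass_ge0 w K M : (forall i, 0 <= w i) -> 0 <= mass w K M.
Proof.
by move=> w0; apply: sumr_ge0 => i _; rewrite mulr_ge0// indicE ler0n.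
Qed.

Lemma mass_le w K M N : (forall i, 0 <= w i) -> M `<=` N ->
  mass w K M <= mass w K N.
Proof.
move=> w0 MN; apply: ler_sum => i _; rewrite ler_wpM2l// !indicE ler_nat.
by case: (boolP (_ \in M)) => // /set_mem/MN/mem_set->.
Qed.

Lemma massU w K M N : (forall i, 0 <= w i) ->
  mass w K (M `|` N) <= mass w K M + mass w K N.
Proof.
move=> w0; rewrite -big_split/=; apply: ler_sum => i _.
rewrite -mulrDr ler_wpM2l// !indicE in_setU -natrD ler_nat.
by case: (_ \in M); case: (_ \in N).
Qed.

Lemma mass0 w K : mass w K set0 = 0.
Proof. by rewrite /mass big1// => i _; rewrite indicE in_set0 mulr0. Qed.

Lemma mass_bigcup_cvg0 (w : nat -> nat -> R) (K : nat -> nat)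
    (e : nat -> set nat) (m : nat) :
  (forall k i, 0 <= w k i) ->
  (forall j, mass (w k) (K k) (e j) @[k --> \oo] --> 0) ->
  mass (w k) (K k) (\bigcup_(j in `I_m) e j) @[k --> \oo] --> 0.
Proof.
move=> w0 e0; elim: m => [|m IH].
  rewrite (_ : \bigcup_(j in _) _ = set0).
    by under eq_fun do rewrite mass0; apply: cvg_cst.
  by rewrite II0 bigcup_set0.
rewrite IIS bigcup_setU bigcup_set1.
have := cvgD IH (e0 m); rewrite addr0 => H.
apply: squeeze_cvgr _ (cvg_cst (0 : R)) (H _).
by apply: nearW => k; rewrite mass_ge0//= massU.
Qed.

Definition prob_weights (w : nat -> R) (K : nat) : Prop :=
  (forall i, 0 <= w i) /\ \sum_(i < K) w i = 1.

(** A finite set lies in a finite union of singletons, whose mass tends to 0. *)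
Lemma infinite_of_mass (w : nat -> nat -> R) (K : nat -> nat) (N : set nat) :
  (forall k i, 0 <= w k i) ->
  (forall i, mass (w k) (K k) [set i] @[k --> \oo] --> 0) ->
  ~ (mass (w k) (K k) N @[k --> \oo] --> 0) -> infinite_set N.
Proof.
move=> w0 i0 nN /finite_set_natP[m mP]; apply: nN.
have H := mass_bigcup_cvg0 m w0 i0; apply: squeeze_cvgr _ (cvg_cst (0 : R)) H.
apply: nearW => k; rewrite mass_ge0//= mass_le// => n /mP nm.
by exists n.
Qed.

Lemma diagonal_set (A : set (set nat)) (w : nat -> nat -> R) (K : nat -> nat) :
  countable A -> (forall k, prob_weights (w k) (K k)) ->
  (forall i, mass (w k) (K k) [set i] @[k --> \oo] --> 0) ->
  (forall M, A M -> mass (w k) (K k) M @[k --> \oo] --> 0) ->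
  exists N, [/\ infinite_set N, forall M, A M -> finite_set (M `&` N) &
                ~ (mass (w k) (K k) N @[k --> \oo] --> 0)].
Proof.
move=> /countable_injP[f finj] wP i0 A0.
have w0 k i : 0 <= w k i by case: (wP k).
(* An enumeration of [A] through [f]; indices that [f] misses get the empty set, which has mass
   0. *)
pose e j := xget set0 [set M | A M /\ f M = j].
have e0 j : mass (w k) (K k) (e j) @[k --> \oo] --> 0.
  rewrite /e; case: xgetP => [M _ [AM _]|_]; first exact: A0.
  by under eq_fun do rewrite mass0; apply: cvg_cst.
have eA M : A M -> e (f M) = M.
  move=> AM; rewrite /e; case: xgetP => [M' _ [AM' /finj]|/(_ M)[]//].
  by apply; rewrite inE.
pose U j := \bigcup_(i in `I_j) e i.
have /choice[c cP] : forall j, exists k,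
    (j <= k)%N /\ mass (w k) (K k) (U j) <= 1 / 2.
  move=> j; have /cvgr0Pnorm_le/(_ (1 / 2) ltac:(lra)) := mass_bigcup_cvg0 j w0 e0.
  move=> Uj; have [k [jk Uk]] := filter_ex (filterI (nbhs_infty_ge j) Uj).
  by exists k; split=> //; apply: le_trans Uk; exact: ler_norm.
(* The whole interval below [K (c j)] replaces the support. It carries the full mass of the measure
   and is still finite. *)
pose N := [set n | exists j, (n < K (c j))%N /\ ~ U j n].
have nN : ~ (mass (w k) (K k) N @[k --> \oo] --> 0).
  move=> /cvgr0Pnorm_lt/(_ (1 / 2) ltac:(lra)) [j _ /(_ (c j) (cP j).1)].
  apply/negP; rewrite -leNgt; apply: le_trans (ler_norm _).
  have [wj0 wj1] := wP (c j); have [_ Uj] := cP j.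
  suff: 1 <= mass (w (c j)) (K (c j)) N + mass (w (c j)) (K (c j)) (U j) by lra.
  rewrite -[leLHS]wj1 -big_split/=; apply: ler_sum => i _.
  rewrite -mulrDr ler_peMr// !indicE -natrD ler1n.
  have [Ui|nUi] := pselect (U j i); first by rewrite (mem_set Ui) addn1.
  by rewrite (@mem_set _ N)//; exists j.
exists N; split=> //; first exact: infinite_of_mass nN.
move=> M AM; apply/finite_set_natP.
(* For [j > f M] the removed set [U j] contains [M], so only the intervals with [j <= f M] can meet
   [M]. *)
exists (\max_(j < (f M).+1) K (c j)) => n [Mn [j [nK nU]]].
apply: leq_trans nK _; have [jf|fj] := leqP j (f M).
  by rewrite -ltnS in jf; exact: (leq_bigmax (Ordinal jf)).
by case: nU; exists (f M); rewrite ?eA.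
Qed.

(* A sequence of weights is coded by its strict rational lower cuts, so that
   the subsets of nat index all of them. *)
Definition code (s : (nat -> nat -> R) * (nat -> nat)) : set nat :=
  [set n | exists k i (q : rat), n = pickle (k, i, q, s.2 k) /\ ratr q < s.1 k i].

Lemma code_inj : injective code.
Proof.
move=> [w K] [w' K'] E.
have sub v L v' L' : code (v, L) `<=` code (v', L') ->
    L = L' /\ forall k i, v k i <= v' k i.
  move=> C.
  have cut k i (q : rat) : ratr q < v k i -> L k = L' k /\ ratr q < v' k i.
    move=> qv; have [|k' [i' [q' [/(pcan_inj pickleK)[-> -> -> ->]]]] //] :=
      C (pickle (k, i, q, L k)).
    by exists k, i, q.
  split=> [|k i].
    (* Any rational below [v k 0] yields a code that records [L k]; the unit interval under [v k 0]
       contains one. *)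
    apply/funext => k; have [|q] := @rat_in_itvoo R (v k 0%N - 1) (v k 0%N).
      by rewrite gtrBl.
    by rewrite in_itv/= => /andP[_ /cut[]].
  rewrite leNgt; apply/negP => vv; have [q] := rat_in_itvoo vv.
  by rewrite in_itv/= => /andP[vq /cut[_ /(lt_trans vq)]]; rewrite ltxx.
have [KK ww] := sub w K w' K' ltac:(by rewrite E).
have [_ w'w] := sub w' K' w K ltac:(by rewrite E).
congr pair => //; apply/funext => k; apply/funext => i.
by apply/eqP; rewrite eq_le ww w'w.
Qed.

(** A sequence not tending to 0 at some point is already excluded by [c0]; only the others need a
    witness in [F]. *)
Definition killed_by (F : set (set nat)) (w : nat -> nat -> R) (K : nat -> nat) :=
  (forall i, mass (w k) (K k) [set i] @[k --> \oo] --> 0) ->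
  exists2 M, F M & ~ (mass (w k) (K k) M @[k --> \oo] --> 0).

(** Disjoint infinite sets placed in the family from the start. They make it infinite and later give
    the filter along which the evaluations tend to 0. *)
Definition column (i : nat) : set nat := range (fun m : nat => pickle (i, m)).

Lemma column_infinite i : infinite_set (column i).
Proof.
have inj : {in [set: nat] &, injective (fun m : nat => pickle (i, m))}.
  by move=> m n _ _ /(pcan_inj pickleK)[].
by rewrite /column (eq_finite_set (inj_card_eq inj)); exact: infinite_nat.
Qed.

Lemma column_disjoint i j : i <> j -> column i `&` column j = set0.
Proof.
move=> ij; apply/seteqP; split=> // _ [[m _ <-] [m' _ /(pcan_inj pickleK)[ji _]]].
exact: ij.
Qed.

Lemma column_inj : injective column.
Proof.
move=> i j E; apply: contrapT => /column_disjoint; rewrite E setIid => E0.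
by have [n] := infinite_setN0 (@column_infinite j); rewrite E0.
Qed.

Lemma killing_family : continuum_hypothesis ->
  exists F, [/\ almost_disjoint F, forall i, F (column i) &
    forall w K, (forall k, prob_weights (w k) (K k)) -> killed_by F w K].
Proof.
move=> /ch_well_order[lt [wf_lt tot_lt ct_lt]].
(* Outside the range of [code] the default has mass 0 on every set, so no set is good at such a
   stage. *)
pose decode T := xget (fun _ _ => 0, fun=> 0%N) [set s | code s = T].
have decodeK s : decode (code s) = s.
  apply: code_inj; apply: (@xgetPex _ _ [set s' | code s' = code s]).
  by exists s.
pose good (A : set (set nat)) s N := [/\ infinite_set N,
  forall M, A M -> finite_set (M `&` N) &
  ~ (mass (s.1 k) (s.2 k) N @[k --> \oo] --> 0)].
pose below T f : set (set nat) := range column `|`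
  [set M | exists U (p : lt U T), f U p = M].
(* If no good set exists, the stage repeats [column 0], already a member, which preserves almost
   disjointness. *)
pose step T (f : forall U, lt U T -> set nat) : set nat :=
  xget (column 0) (good (below T f) (decode T)).
pose N := Fix wf_lt (fun=> set nat) step.
have NE T : N T = step T (fun U _ => N U).
  (* Unfolding the recursion requires that [step] depend only on the values of [f]. *)
  apply: Fix_eq => x f g fg; congr step.
  by apply: functional_extensionality_dep => U; apply/funext => p; exact: fg.
pose A T := below T (fun U _ => N U).
have N_spec T : N T = column 0 \/ good (A T) (decode T) (N T).
  by rewrite NE /step; case: xgetP => [M -> gM|_]; [right|left].
have A_col T i : A T (column i) by left; exists i.
have A_lt T U : lt U T -> A T (N U) by move=> UT; right; exists U, UT.
exists (range column `|` range N); split.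
- split=> [M [[i _ <-]|[T _ <-]]|].
  + exact: column_infinite.
  + by case: (N_spec T) => [->|[]//]; exact: column_infinite.
  have col_N i T : column i <> N T -> finite_set (column i `&` N T).
    case: (N_spec T) => [->|[_ fin _ _]]; last exact: fin.
    by move=> ne; rewrite column_disjoint// => i0; apply: ne; rewrite i0.
  have N_N T U : lt U T -> N U <> N T -> finite_set (N U `&` N T).
    move=> UT; case: (N_spec T) => [->|[_ fin _] _]; last exact/fin/A_lt.
    by rewrite setIC => ne; apply: col_N => /esym.
  move=> M M' [[i _ <-]|[T _ <-]] [[j _ <-]|[U _ <-]] ne.
  + by rewrite column_disjoint// => ij; apply: ne; rewrite ij.
  + exact: col_N.
  + by rewrite setIC; apply: col_N => /esym.
  + have [|TU|UT] := tot_lt T U; first by move=> TU; apply: ne; rewrite TU.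
      exact: N_N.
    by rewrite setIC; apply: N_N => // /esym.
- by move=> i; left; exists i.
- move=> w K wP i0; apply: contrapT => nF.
  have cvgF M : (range column `|` range N) M ->
      mass (w k) (K k) M @[k --> \oo] --> 0.
    by move=> FM; apply: contrapT => nM; apply: nF; exists M.
  (* If every member had mass tending to 0, the countable set [A T] would admit a good set at the
     stage [T] of this sequence. Then [N T] would be good, yet it is itself a member. *)
  pose T := code (w, K).
  have AF : A T `<=` range column `|` range N.
    by move=> M [|[U [_ <-]]]; [left|right; exists U].
  have ctA : countable (A T).
    rewrite /A /below -bigcup2E; apply: bigcup_countable => // -[_|[_|//]] /=.
      exact: sub_countable (card_image_le _ _) _.
    apply: sub_countable (ct_lt T); apply: card_le_trans (card_image_le N _).
    by apply: subset_card_le => _ [U [UT <-]]; exists U.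
  have [M gM] : exists M, good (A T) (decode T) M.
    by rewrite /good decodeK; apply: diagonal_set => // M /AF/cvgF.
  have : good (A T) (decode T) (N T) by rewrite NE /step; apply: xgetPex; exists M.
  by rewrite /good decodeK => -[_ _]; apply; apply: cvgF; right; exists T.
Qed.

(** For a new set [P], the Dirac measures at points [p k >= k] of [P] tend to 0 on points, and on
    each [M] in [F] because [M] meets [P] in a finite set. So nothing in [F] would kill them. *)
Lemma killing_family_mad F : almost_disjoint F ->
  (forall w K, (forall k, prob_weights (w k) (K k)) -> killed_by F w K) ->
  mad_family F.
Proof.
move=> adF killF; split=> // G adG FG; apply/seteqP; split=> // P GP.
apply: contrapT => nFP.
have /choice[p pP] : forall k, exists n, P n /\ (k <= n)%N.
  move=> k; apply: contrapT => nk; apply: (adG.1 _ GP); apply/finite_set_natP.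
  by exists k => n Pn; rewrite ltnNge; apply/negP => kn; apply: nk; exists n.
pose w k i : R := (i == p k)%:R.
have massE k M : mass (w k) (p k).+1 M = \1_M (p k).
  rewrite /mass big_ord_recr/= /w eqxx mul1r big1 ?add0r// => i _.
  by rewrite ltn_eqF ?mul0r.
have [k||M FM] := killF w (fun k => (p k).+1).
- split=> [i|]; first exact: ler0n.
  have E := massE k setT; rewrite [RHS]indicE in_setT in E.
  rewrite -[RHS]E; apply: eq_bigr => i _.
  by rewrite indicE in_setT mulr1.
- move=> i; apply: cvg_near_cst; exists i.+1 => // k ik /=; rewrite massE indicE.
  rewrite memNset// => /= pki; have := (pP k).2; rewrite pki.
  by rewrite leqNgt ik.
- apply; apply: cvg_near_cst.
  have [|m mP] := (finite_set_natP (M `&` P)).1 _.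
    by apply: adG.2 => //; [exact: FG | move=> MP; apply: nFP; rewrite -MP].
  exists m => // k mk /=; rewrite massE indicE memNset// => Mpk.
  have := mP _ (conj Mpk (pP k).1); rewrite ltnNge => /negP; apply.
  exact: leq_trans mk (pP k).2.
Qed.

End Diagonal.

(** * Failure of property (E) *)

Lemma sum_sub_seq (R : nzRingType) (V : lmodType R) (T : eqType)
    (s t : seq T) (a : T -> R) (v : T -> V) :
  uniq s -> uniq t -> {subset s <= t} ->
  \sum_(N <- s) a N *: v N = \sum_(N <- t) (if N \in s then a N else 0) *: v N.
Proof.
move=> us ut st.
rewrite [RHS](eq_bigr (fun N => if N \in s then a N *: v N else 0))
  => [|N _]; last first.
  by case: ifP => _; rewrite ?scale0r.
rewrite -big_mkcond -[RHS]big_filter; apply: perm_big.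
apply: uniq_perm => // [|N]; first exact: filter_uniq.
rewrite mem_filter; case: (boolP (N \in s)) => //= /st->.
by [].
Qed.

(** The norm formula speaks only of combinations of distinct sets, so each element of the span has
    to be put in that form. *)
Lemma jl_span_repr (R : realType) (F : set (set nat)) (y : nat -> R^o) :
  jl_span F y -> exists (x : nat -> R^o) k (a : 'I_k -> R) (N : 'I_k -> set nat),
    [/\ c0 x, injective N, forall r, F (N r) &
        y = x + \sum_(r < k) a r *: (\1_(N r) : nat -> R^o)].
Proof.
(* Duplicate-free lists with coefficients indexed by sets are easier to add: both sums are extended
   by zero to a common list. *)
move=> Fy; suff [x [s [a [x0 us sF ->]]]] :
  exists (x : nat -> R^o) (s : seq (set nat)) (a : set nat -> R),
    [/\ c0 x, uniq s, forall N, N \in s -> F N &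
        y = x + \sum_(N <- s) a N *: (\1_N : nat -> R^o)].
  exists x, (size s), (fun r => a (nth set0 s r)), (fun r => nth set0 s r).
  split=> // [r r' /eqP|r|]; last 1 first.
  - by rewrite (big_nth set0) big_mkord.
  - by rewrite nth_uniq// => /eqP/val_inj.
  - exact/sF/mem_nth.
have c00 : c0 (0 : nat -> R^o) by apply: cvg_cst.
move: y Fy; apply: jl_span_ind.
- split=> [|c _ _ [x [s [a [x0 us sF ->]]]] [z [t [b [z0 ut tF ->]]]]].
    by exists 0, [::], (fun=> 0); split=> //; rewrite big_nil addr0.
  exists (c *: x + z), (undup (s ++ t)),
    (fun N => c * (if N \in s then a N else 0) + (if N \in t then b N else 0)).
  have uu := undup_uniq (s ++ t).
  split=> //.
  + have := cvgD (cvgZl_tmp (k := c) x0) z0.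
    by rewrite scaler0 addr0; apply.
  + by move=> N; rewrite mem_undup mem_cat => /orP[/sF|/tF].
  + rewrite (sum_sub_seq _ _ us uu) => [|N Ns]; last first.
      by rewrite mem_undup mem_cat Ns.
    rewrite (sum_sub_seq _ _ ut uu) => [|N Nt]; last first.
      by rewrite mem_undup mem_cat Nt orbT.
    rewrite scalerDr addrACA; congr (_ + _).
    rewrite scaler_sumr -big_split/=; apply: eq_bigr => N _.
    by rewrite scalerA scalerDl.
- move=> x x0; exists x, [::], (fun=> 0); split=> //.
  by rewrite big_nil addr0.
- move=> N FN; exists 0, [:: N], (fun=> 1); split=> // [M|].
    by rewrite inE => /eqP->.
  by rewrite big_seq1 scale1r add0r.
Qed.

(** * Evaluation functionals on an arbitrary completion *)

Section evaluation.
Context (R : realType) (F : set (set nat)) (X : completeNormedModType R).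
Context (j : (nat -> R^o) -> X).
Hypotheses (adF : almost_disjoint F) (hj : JL2_completion F j).

Let span0 : jl_span F (0 : nat -> R^o).
Proof. by have [] := @jl_span_linear R F. Qed.

Let spanP a (u v : nat -> R^o) : jl_span F u -> jl_span F v -> jl_span F (a *: u + v).
Proof. by have [_] := @jl_span_linear R F; apply. Qed.

Let j_lin a (u v : nat -> R^o) : jl_span F u -> jl_span F v ->
  j (a *: u + v) = a *: j u + j v.
Proof. by have [h _ _] := hj; apply: h. Qed.

Let j0 : j 0 = 0.
Proof. by have := j_lin (-1) span0 span0; rewrite scaler0 addr0 scaleN1r addNr. Qed.

Lemma eval_le_norm (y : nat -> R^o) (n : nat) : jl_span F y -> `|y n| <= `|j y|.
Proof.
(* Boundedness of [y] makes [sup_norm y] a genuine supremum. *)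
move=> Fy; have [B yB] := jl_embed_bounded adF Fy.
have [x [k [a [N [x0 injN FN yE]]]]] := jl_span_repr Fy.
have [_ jnorm _] := hj; rewrite [in leRHS]yE jnorm// -yE le_max; apply/orP; left.
by apply: ub_le_sup; [exists B => _ [m _ <-]; exact: (yB (Eval R F m))|exists n].
Qed.

Lemma jl_dense (x : X) (e : R) : 0 < e ->
  exists2 y, jl_span F y & `|j y - x| <= e.
Proof.
move=> e0; have [_ _ jd] := hj.
have [||z [xe [y Fy yz]]] := jd (ball x e).
- by exists x; exact: ballxx.
- exact: ball_open.
- exists y => //; move: xe; rewrite yz -ball_normE /ball_/= distrC.
  exact: ltW.
Qed.

(* McShane's formula for extending a 1-Lipschitz function; linearity comes from
   the density of the span. *)
Definition eval_ext (n : nat) (x : X) : R^o :=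
  sup [set y n - `|j y - x| | y in @jl_span R F].

(** Evaluation is 1-Lipschitz on the span, so each lower bound in McShane's formula is below each
    upper bound. This estimate gives the values on the span, the norm bound and linearity. *)
Lemma eval_extP (n : nat) (x : X) (y : nat -> R^o) :
  jl_span F y -> `|y n - eval_ext n x| <= `|j y - x|.
Proof.
move=> Fy.
have key (z z' : nat -> R^o) : jl_span F z -> jl_span F z' ->
    z n - `|j z - x| <= z' n + `|j z' - x|.
  move=> Fz Fz'; have := eval_le_norm n (spanP (-1) Fz' Fz).
  rewrite j_lin// !scaleN1r.
  rewrite (_ : (- z' + z) n = z n - z' n); last by rewrite addrC.
  move=> zz'; rewrite lerBlDr -addrA -lerBlDl.
  apply: le_trans (ler_norm _) _; apply: le_trans zz' _.
  have -> : - j z' + j z = (j z - x) - (j z' - x).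
    by rewrite opprB addrA subrK addrC.
  by rewrite [leRHS]addrC ler_normB.
have hs : has_sup [set y n - `|j y - x| | y in @jl_span R F].
  split; first by exists (0 n - `|j 0 - x|); exists 0.
  by exists (y n + `|j y - x|) => _ [z Fz <-]; exact: key.
have lo : y n - `|j y - x| <= eval_ext n x.
  by apply: ub_le_sup; [case: hs | exists y].
have up : eval_ext n x <= y n + `|j y - x|.
  by apply: sup_le_ub => [|_ [z Fz <-]]; [case: hs | exact: key].
by rewrite ler_norml lerBrDr lerBlDr addrC lerBlDr up -lerBlDl.
Qed.

Lemma eval_ext_j (n : nat) (y : nat -> R^o) : jl_span F y -> eval_ext n (j y) = y n.
Proof.
move=> Fy; have := eval_extP n (j y) Fy.
by rewrite subrr normr0 normr_le0 subr_eq0 => /eqP.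
Qed.

Lemma eval_ext_le (n : nat) (x : X) : `|eval_ext n x| <= `|x|.
Proof.
by have := eval_extP n x span0; rewrite j0 !sub0r !normrN.
Qed.

Lemma eval_ext_linear (n : nat) : linear (eval_ext n).
Proof.
move=> a u v; apply/eqP; rewrite -subr_eq0 -normr_le0; apply/ler_addgt0Pl => e e0.
(* Both sides lie within [(|a| + 1) * d = e / 2] of the value at the approximating element of the
   span. *)
rewrite addr0; pose d := e / (`|a| + 1) / 2.
have a1 : 0 < `|a| + 1 by rewrite ltr_wpDl.
have d0 : 0 < d by rewrite !divr_gt0.
have [y Fy yu] := jl_dense u d0; have [z Fz zv] := jl_dense v d0.
have l1 : `|(a *: y + z) n - eval_ext n (a *: u + v)| <= `|a| * d + d.
  apply: le_trans (eval_extP _ _ (spanP a Fy Fz)) _; rewrite j_lin//.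
  rewrite opprD addrACA -scalerBr (le_trans (ler_normD _ _))// lerD//.
  by rewrite normrZ ler_wpM2l.
have l2 : `|(a *: y + z) n - (a *: eval_ext n u + eval_ext n v)| <= `|a| * d + d.
  rewrite opprD addrACA -scalerBr (le_trans (ler_normD _ _))// lerD//.
    by rewrite normrZ ler_wpM2l// (le_trans (eval_extP _ _ Fy)).
  by rewrite (le_trans (eval_extP _ _ Fz)).
have -> : e = (`|a| * d + d) + (`|a| * d + d).
  by rewrite /d; field; rewrite gt_eqF.
by rewrite (le_trans (ler_distD ((a *: y + z) n) _ _))// lerD// distrC.
Qed.

Definition conv_evals : set (X -> R^o) :=
  [set g | exists w K, prob_weights w K /\
                       g = fun x => \sum_(i < K) w i * eval_ext i x].

Lemma conv_evals_le g x : conv_evals g -> `|g x| <= `|x|.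
Proof.
move=> [w [K [[w0 w1] ->]]]; apply: le_trans (ler_norm_sum _ _ _) _.
rewrite -[leRHS]mul1r -w1 mulr_suml; apply: ler_sum => i _.
by rewrite normrM ger0_norm// ler_wpM2l// eval_ext_le.
Qed.

Lemma conv_evals_linear g : conv_evals g -> linear g.
Proof.
move=> [w [K [_ ->]]] a u v; rewrite scaler_sumr -big_split/=.
apply: eq_bigr => i _; rewrite eval_ext_linear mulrDr.
by rewrite -![a *: _]/(a * _) mulrCA.
Qed.

Lemma conv_evals_dual : conv_evals `<=` @topological_dual R X.
Proof.
move=> g Cg; have glin := conv_evals_linear Cg; split=> // x.
apply/cvgrPdist_le => e e0; near=> y.
have -> : g x - g y = g (x - y).
  by rewrite [x - y]addrC -(scaleN1r y) (glin (-1) y x) scaleN1r addrC.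
apply: le_trans (conv_evals_le _ Cg) _; near: y.
exact: cvgr_dist_le.
Unshelve. all: by end_near. Qed.

Lemma conv_evals_bounded : uniform_bounded conv_evals.
Proof.
move=> r; exists r => g Cg x xr.
exact: le_trans (conv_evals_le _ Cg) xr.
Qed.

Lemma conv_evals_convex : convex_set conv_evals.
Proof.
move=> _ _ l /set_mem[w [K [[w0 w1] ->]]] /set_mem[w' [K' [[w'0 w'1] ->]]].
apply/mem_set.
(* Both weight vectors are padded by zeros to a common length. *)
pose t (L : nat) (v : nat -> R) i := if (i < L)%N then v i else 0.
have tE (L : nat) v (G : nat -> R) : (L <= maxn K K')%N ->
    \sum_(i < maxn K K') t L v i * G i = \sum_(i < L) v i * G i.
  move=> LK; rewrite (big_ord_widen _ (fun i => v i * G i) LK) [RHS]big_mkcond.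
  by apply: eq_bigr => i _; rewrite /t; case: ifP => // _; rewrite mul0r.
exists (fun i => l%:num * t K w i + (1 - l%:num) * t K' w' i), (maxn K K').
have l1 : 0 <= 1 - l%:num by rewrite subr_ge0.
(* Used with [G = 1] for the total mass and with the evaluations for the functional itself. *)
have main (G : nat -> R) :
    \sum_(i < maxn K K') (l%:num * t K w i + (1 - l%:num) * t K' w' i) * G i =
    l%:num * (\sum_(i < K) w i * G i) + (1 - l%:num) * (\sum_(i < K') w' i * G i).
  rewrite -(tE K) ?leq_maxl// -(tE K') ?leq_maxr// !mulr_sumr -big_split/=.
  by apply: eq_bigr => i _; rewrite mulrDl !mulrA.
split.
  split=> [i|].
    by rewrite addr_ge0// mulr_ge0// /t; case: ifP.
  have := main (fun=> 1); rewrite -!mulr_suml !mulr1 w1 w'1 !mulr1 => ->.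
  by rewrite addrC subrK.
by apply/funext => x; exact: esym (main (fun i => eval_ext i x)).
Qed.

(** * Zero as a weak* limit point but not a sequential limit *)

Section not_efremov.
Hypothesis colF : forall i, F (column i).

(* Every member of F meets almost all columns in a finite set, hence is
   negligible for this filter. *)
Definition column_filter : set_system nat :=
  [set U | \forall i \near \oo, along (column i) U].

Lemma column_filter_proper : ProperFilter column_filter.
Proof.
have FF : Filter column_filter.
  constructor=> [|U V uU uV|U V UV]; first by apply: nearW => i; exact: filterT.
    by apply: (@filterS2 nat \oo) uU uV => i; exact: filterI.
  by apply: (@filterS nat \oo) => i; exact: filterS.
apply: Build_ProperFilter_ex => U FU; have [i iU] := @filter_ex nat \oo _ _ FU.
have PN := along_proper (@column_infinite i); exact: filter_ex iU.
Qed.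

(** Density and the bound of [eval_extP] reduce the claim to the span, and there to null sequences
    and indicators. *)
Lemma eval_ext_cvg0 (x : X) : eval_ext n x @[n --> column_filter] --> (0 : R^o).
Proof.
have PF := column_filter_proper.
have cvgF (y : nat -> R^o) : jl_span F y -> y @ column_filter --> (0 : R^o).
  move: y; apply: jl_span_ind.
  - split=> [|a u v u0 v0]; first exact: cvg_cst.
    have := cvgD (cvgZl_tmp (k := a) u0) v0.
    by rewrite scaler0 addr0; apply.
  - move=> y y0; apply: cvg_trans y0; apply: cvg_app => U oU.
    by apply: (@nearW nat \oo) => i; exact: cvg_within oU.
  - move=> M FM; apply: cvg_near_cst.
    (* The columns are distinct, so at most one equals [M]; almost disjointness applies to all later
       ones. *)
    have : \forall i \near \oo, column i <> M.
      have [[i0 i0M]|nM] := pselect (exists i, column i = M); last first.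
        by apply: nearW => i iM; apply: nM; exists i.
      exists i0.+1 => // i /= ii0; rewrite -i0M => /column_inj ii.
      by rewrite ii ltnn in ii0.
    apply: filterS => i iM; apply: near_indic_along0; rewrite setIC.
    by apply: adF.2.
apply/cvgr0Pnorm_le => e e0; have e2 : 0 < e / 2 by rewrite divr_gt0.
have [y Fy yx] := jl_dense x e2.
have /cvgr0Pnorm_le/(_ _ e2) := cvgF _ Fy; apply: filterS => n yn.
rewrite -[eval_ext n x](subrK (y n)) (le_trans (ler_normD _ _))//.
by rewrite [leRHS]splitr lerD// distrC (le_trans (eval_extP _ _ Fy)).
Qed.

Lemma closure_conv_evals :
  closure (conv_evals : set {ptws X -> R^o}) (fun=> 0 : R^o).
Proof.
have PF := column_filter_proper.
rewrite closureEcvg; exists (eval_ext @ column_filter).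
  exact: fmap_proper_filter.
split.
  exact/pointwise_cvgP/eval_ext_cvg0.
move=> U CU; apply: (@nearW nat column_filter) => n; apply: (CU (eval_ext n)).
(* Each evaluation is the combination given by the Dirac measure at [n], so the image filter lives
   on [conv_evals]. *)
exists (fun i => (i == n)%:R), n.+1.
have sumE (G : nat -> R) : \sum_(i < n.+1) (i == n :> nat)%:R * G i = G n.
  rewrite big_ord_recr/= eqxx mul1r big1 ?add0r// => i _.
  by rewrite ltn_eqF ?mul0r.
split; last by apply/funext => x; exact: esym (sumE (fun i => eval_ext i x)).
split=> [i|]; first exact: ler0n.
by rewrite -[RHS](sumE (fun=> 1)); apply: eq_bigr => i _; rewrite mulr1.
Qed.

(** Testing a weak* null sequence of combinations at [j \1_M] gives the masses of [M]; singletons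
    and members of [F] both lie in the span, against [killF]. *)
Lemma not_efremov : (forall w K, (forall k, prob_weights (w k) (K k)) ->
  @killed_by R F w K) -> ~ efremov_property X.
Proof.
move=> killF /(_ conv_evals conv_evals_dual conv_evals_convex conv_evals_bounded).
move=> /(_ (fun=> 0) _ closure_conv_evals) [|u [Cu u0]].
  split=> [a x y|]; first by rewrite scaler0 addr0.
  by move=> x; exact: cvg_cst.
have /choice[wK wKP] : forall n, exists wK : (nat -> R) * nat,
    prob_weights wK.1 wK.2 /\ u n = fun x => \sum_(i < wK.2) wK.1 i * eval_ext i x.
  by move=> n; have [w [K ?]] := Cu n; exists (w, K).
have uE n M : jl_span F (\1_M : nat -> R^o) ->
    u n (j \1_M) = mass (wK n).1 (wK n).2 M.
  move=> FM; rewrite (wKP n).2; apply: eq_bigr => i _.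
  by rewrite eval_ext_j.
have u0M M : jl_span F (\1_M : nat -> R^o) ->
    mass (wK n).1 (wK n).2 M @[n --> \oo] --> 0.
  move=> FM; under eq_fun do rewrite -uE//.
  by have /pointwise_cvgP/(_ (j \1_M)) := u0.
have [||M FM] := killF (fun n => (wK n).1) (fun n => (wK n).2).
- by move=> n; exact: (wKP n).1.
- move=> i; apply: u0M; apply: jl_span_c0; apply: cvg_near_cst.
  exists i.+1 => // n ni /=; rewrite indicE memNset//= => nE.
  by have : (i < n)%N := ni; rewrite nE ltnn.
- by apply; apply: u0M; exact: jl_span_indic.
Qed.

End not_efremov.

End evaluation.

Theorem theorem4p4 (R : realType) (CH : continuum_hypothesis) :
  exists F : set (set nat),
    [/\ mad_family F,
        exists X : completeNormedModType R, is_JL2 F X &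
        forall X : completeNormedModType R, is_JL2 F X -> ~ efremov_property X].
Proof.
have [F [adF colF killF]] := @killing_family R CH.
exists F; split.
- exact: killing_family_mad killF.
- by exists (bclosure (jl_image R adF)); exact: is_JL2_exists.
- by move=> X [j hj]; exact: not_efremov hj colF killF.
Qed.
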